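(* Let $n\ge 1$ and let $K$ be an irreducible birth and death chain on $\{0,1,\dots,n\}$ with birth, death and holding rates $p_i,q_i,r_i$ and stationary distribution $\pi$. Let $i_0\in\{0,\dots,n\}$ be a state satisfying $\pi([0,i_0])\ge 1/2$ and $\pi([i_0,n])\ge 1/2$, and set \[ t=\max\left\{\sum_{k=0}^{i_0-1}\frac{\pi([0,k])}{\pi(k)p_k},\ \sum_{k=i_0+1}^n\frac{\pi([k,n])}{\pi(k)q_k}\right\}. \] Then, for any $\delta\in[1/2,1)$, \[ \min\left\{T_{\mathrm{TV}}^{(c)}(1/10),\,T_{\mathrm{TV}}^{(\delta)}(1/20)\right\}\ge \frac{t}{6}, \] and \[ \max\left\{T_{\mathrm{TV}}^{(c)}(\epsilon),\,(1-\delta)T_{\mathrm{TV}}^{(\delta)}(\epsilon)\right\}\le\frac{18t}{\epsilon^2},\quad\forall\epsilon\in(0,1). \]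
   Context: A birth and death chain on $\{0,1,\dots,n\}$ with birth rates $p_i$, death rates $q_i$ and holding rates $r_i$ (nonnegative, $p_i+q_i+r_i=1$, $p_n=q_0=0$) is the Markov chain with transition matrix $K(i,i+1)=p_i$, $K(i,i-1)=q_i$, $K(i,i)=r_i$ and all other entries $0$. It is irreducible iff $p_iq_{i+1}>0$ for $0\le i<n$, and then it has a unique stationary distribution $\pi$. Write $\pi(A)=\sum_{i\in A}\pi(i)$, with $[a,b]$ denoting the integers between $a$ and $b$. Empty sums are $0$. The associated continuous time semigroup is $H_t=e^{-t(I-K)}=\sum_{i\ge0}e^{-t}t^iK^i/i!$, and the $\delta$-lazy chain is $K_\delta=\delta I+(1-\delta)K$. With $\|\mu-\nu\|_{\mathrm{TV}}=\sup_A\{\mu(A)-\nu(A)\}$, set $d^{(c)}_{\mathrm{TV}}(t)=\sup_x\|H_t(x,\cdot)-\pi\|_{\mathrm{TV}}$ for real $t\ge 0$ and $d^{(\delta)}_{\mathrm{TV}}(m)=\sup_x\|K_\delta^m(x,\cdot)-\pi\|_{\mathrm{TV}}$ for integers $m\ge0$. The mixing times are $T^{(c)}_{\mathrm{TV}}(\epsilon)=\inf\{t\ge0: d^{(c)}_{\mathrm{TV}}(t)\le\epsilon\}$ and $T^{(\delta)}_{\mathrm{TV}}(\epsilon)=\inf\{m\in\mathbb{Z}_{\ge 0}: d^{(\delta)}_{\mathrm{TV}}(m)\le\epsilon\}$. *)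

(* Defs.v *)
From HB Require Import structures.
From mathcomp Require Import all_boot all_order all_algebra.
From mathcomp Require Import all_classical all_reals all_analysis.

Set Implicit Arguments.
Unset Strict Implicit.
Unset Printing Implicit Defensive.

Import Order.TTheory GRing.Theory Num.Theory.
Import numFieldNormedType.Exports.

Local Open Scope classical_set_scope.
Local Open Scope ring_scope.

(* The state space {0,...,n} is 'I_n.+1; distributions are row vectors, so the
   law at time m of the chain K started at x is row x (K ^+ m). *)

Record birth_death_rates (R : realType) (n : nat) (p q r : 'I_n.+1 -> R) :
    Prop := BirthDeathRates {
  birth_ge0 : forall i, 0 <= p i;
  death_ge0 : forall i, 0 <= q i;
  hold_ge0 : forall i, 0 <= r i;
  rates_sum1 : forall i, p i + q i + r i = 1;
  birth_last : p ord_max = 0;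
  death_first : q ord0 = 0 }.

Definition birth_death_mx (R : realType) (n : nat) (p q r : 'I_n.+1 -> R) :
    'M[R]_n.+1 :=
  \matrix_(i, j) if j == i.+1 :> nat then p i
                 else if i == j.+1 :> nat then q i
                 else if i == j then r i
                 else 0.

Definition irreducible_chain (R : realType) (n : nat) (K : 'M[R]_n.+1) : Prop :=
  forall x y, exists m : nat, 0 < (K ^+ m) x y.

Definition is_distribution (R : realType) (n : nat) (mu : 'rV[R]_n.+1) : Prop :=
  (forall i, 0 <= mu 0 i) /\ \sum_i mu 0 i = 1.

Definition stationary_distribution (R : realType) (n : nat) (K : 'M[R]_n.+1)
    (mu : 'rV[R]_n.+1) : Prop :=
  is_distribution mu /\ mu *m K = mu.

Definition mass (R : realType) (n : nat) (mu : 'rV[R]_n.+1)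
    (A : {set 'I_n.+1}) : R :=
  \sum_(i in A) mu 0 i.

Definition states (n a b : nat) : {set 'I_n.+1} :=
  [set i : 'I_n.+1 | (a <= i <= b)%N]%SET.

Definition tv_dist (R : realType) (n : nat) (mu nu : 'rV[R]_n.+1) : R :=
  sup (range (fun A : {set 'I_n.+1} => mass mu A - mass nu A)).

(* The series of matrices defining exp (- t (I - K)), summed entrywise. *)
Definition semigroup (R : realType) (n : nat) (K : 'M[R]_n.+1) (t : R) :
    'M[R]_n.+1 :=
  \matrix_(x, y)
    limn (series (fun i : nat => expR (- t) * t ^+ i * (K ^+ i) x y / i`!%:R)).

Definition lazy_chain (R : realType) (n : nat) (delta : R) (K : 'M[R]_n.+1) :
    'M[R]_n.+1 :=
  delta *: 1%:M + (1 - delta) *: K.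

Definition max_tv_dist (R : realType) (n : nat) (P : 'M[R]_n.+1)
    (mu : 'rV[R]_n.+1) : R :=
  sup (range (fun x : 'I_n.+1 => tv_dist (row x P) mu)).

(* Mixing times are extended reals, so that the infimum of the empty set is
   +oo rather than the default value of the real-valued inf. *)
Definition ct_mixing_time (R : realType) (n : nat) (K : 'M[R]_n.+1)
    (mu : 'rV[R]_n.+1) (eps : R) : \bar R :=
  ereal_inf [set t%:E | t in
    [set t : R | 0 <= t /\ max_tv_dist (semigroup K t) mu <= eps]].

Definition lazy_mixing_time (R : realType) (n : nat) (delta : R)
    (K : 'M[R]_n.+1) (mu : 'rV[R]_n.+1) (eps : R) : \bar R :=
  ereal_inf [set m%:R%:E | m in
    [set m : nat | max_tv_dist (lazy_chain delta K ^+ m) mu <= eps]].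

Definition hitting_sum (R : realType) (n : nat) (p q : 'I_n.+1 -> R)
    (mu : 'rV[R]_n.+1) (i0 : 'I_n.+1) : R :=
  Num.max
    (\sum_(k < n.+1 | (k < i0)%N) mass mu (states n 0 k) / (mu 0 k * p k))
    (\sum_(k < n.+1 | (i0 < k)%N) mass mu (states n k n) / (mu 0 k * q k)).

(* Main.v *)
(* Let tl and tr be the two sums, whose maximum is t, and let
   G(x) = sum_(k < min(x, i0)) pi([0,k]) / (pi(k) p_k); detailed balance gives
   K G <= G + 1.

   Lower bound: h = 1 + theta G satisfies K h <= (1 + theta) h, so from state 0
   the mass of [i0,n] at time s is at most e^(theta s) / (1 + theta tl). With
   theta = 5 / t and s <= t / 6 this is below 2/5, while pi([i0,n]) >= 1/2; if
   tr > tl, argue from state n instead.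

   Upper bound: for delta >= 1/2, K_delta = (I + P) / 2 with P stochastic, so
   two copies of the chain can be coupled by moving only one of them at each step;
   they cannot cross without meeting. For f with values in [0,1] and f_m =
   K_delta^m f, put a_m(x) = sum_(z > x) pi(z) |f_m(x) - f_m(z)|. Stationarity
   of the second copy gives a_(m+1) <= K_delta a_m. Since a_m <= e where
   pi((x,n]) <= e, comparison with the expected hitting time E of that set of
   states yields a_m <= e + E / (m + 1); similarly for z < x. Both hitting times
   are bounded by tl, tr, tl / e and tr / e, and e = eps / 4 gives the claim for
   K_delta. The semigroup at time s is the Poisson(2 s) mixture of the powers of
   K_(1/2), and the average of 2 s / (m + 1) under Poisson(2 s) is at most 1. *)

Require Import Defs.
From HB Require Import structures.
From mathcomp Require Import all_boot all_order all_algebra.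
From mathcomp Require Import all_classical all_reals all_analysis.
From mathcomp Require Import ring lra.

Set Implicit Arguments.
Unset Strict Implicit.
Unset Printing Implicit Defensive.

Import Order.TTheory GRing.Theory Num.Theory.
Import numFieldNormedType.Exports.

Local Open Scope classical_set_scope.
Local Open Scope ring_scope.

(** * Transition operators acting on functions, lazy chains, stationarity *)

Definition act (R : realType) (n : nat) (A : 'M[R]_n.+1) (f : 'I_n.+1 -> R)
  (x : 'I_n.+1) : R := \sum_y A x y * f y.

Definition stochastic (R : realType) (n : nat) (A : 'M[R]_n.+1) : Prop :=
  (forall x y, 0 <= A x y) /\ forall x, \sum_y A x y = 1.

Section Stochastic.
Variables (R : realType) (n : nat).
Implicit Types (A B P : 'M[R]_n.+1) (f g : 'I_n.+1 -> R) (mu : 'rV[R]_n.+1).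

Lemma actM A B f x : act (A * B) f x = act A (act B f) x.
Proof.
rewrite /act; under eq_bigr do rewrite mxE mulr_suml.
rewrite exchange_big /=; apply: eq_bigr => z _.
by rewrite mulr_sumr; apply: eq_bigr => y _; rewrite mulrA.
Qed.

Lemma act1 f x : act 1 f x = f x.
Proof.
rewrite /act (bigD1 x) //= mxE eqxx mul1r big1 ?addr0 // => y yx.
by rewrite mxE eq_sym (negbTE yx) mul0r.
Qed.

Lemma actXS A m f x : act (A ^+ m.+1) f x = act A (act (A ^+ m) f) x.
Proof. by rewrite exprS actM. Qed.

Lemma act_le A f g x : (forall y, 0 <= A x y) -> (forall y, f y <= g y) ->
  act A f x <= act A g x.
Proof. by move=> A0 fg; apply: ler_sum => y _; apply: ler_wpM2l. Qed.

Lemma actD A f g x : act A (fun y => f y + g y) x = act A f x + act A g x.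
Proof. by rewrite -big_split; apply: eq_bigr => y _; rewrite mulrDr. Qed.

Lemma actZ A (c : R) f x : act A (fun y => c * f y) x = c * act A f x.
Proof.
by rewrite /act mulr_sumr; apply: eq_bigr => y _; rewrite mulrCA.
Qed.

Lemma act_one A x : act A (fun=> 1) x = \sum_y A x y.
Proof. by apply: eq_bigr => y _; rewrite mulr1. Qed.

Lemma act_cst P (c : R) x : stochastic P -> act P (fun=> c) x = c.
Proof. by move=> [_ P1]; rewrite /act -mulr_suml P1 mul1r. Qed.

Lemma act_itv01 P f x : stochastic P -> (forall y, 0 <= f y <= 1) ->
  0 <= act P f x <= 1.
Proof.
move=> sP f01; rewrite -[X in _ && (_ <= X)](act_cst 1 x sP) act_le.
- rewrite andbT; apply: sumr_ge0 => y _; rewrite mulr_ge0 ?sP.1 //.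
  by have /andP[] := f01 y.
- exact: sP.1.
- by move=> y; have /andP[] := f01 y.
Qed.

Lemma act_lazy delta P f x :
  act (lazy_chain delta P) f x = delta * f x + (1 - delta) * act P f x.
Proof.
rewrite /act /lazy_chain; under eq_bigr do
  rewrite mxE mulrDl [(_ *: 1%:M)%R _ _]mxE [(_ *: P)%R _ _]mxE -!mulrA.
rewrite big_split /= -!mulr_sumr; congr (_ * _ + _).
exact: act1.
Qed.

Lemma stochastic_lazy delta P : 0 <= delta <= 1 -> stochastic P ->
  stochastic (lazy_chain delta P).
Proof.
move=> /andP[d0 d1] sP; split=> [x y|x].
  rewrite !mxE addr_ge0 // mulr_ge0 ?subr_ge0 ?ler0n //; exact: sP.1.
by rewrite -act_one act_lazy act_cst //; ring.
Qed.

Lemma stochasticX P m : stochastic P -> stochastic (P ^+ m).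
Proof.
move=> sP; elim: m => [|m [IH0 IH1]].
  rewrite expr0; split=> [x y|x]; first by rewrite mxE ler0n.
  by rewrite -act_one act1.
split=> [x y|x].
  by rewrite exprS mxE sumr_ge0 // => z _; rewrite mulr_ge0 //; case: sP.
rewrite -act_one actXS -[RHS](act_cst 1 x sP); apply: eq_bigr => y _.
by rewrite act_one IH1.
Qed.

(** The assumption delta >= 1/2 enters through this identity: it makes [2 * delta - 1] a holding
    probability, so that each lazy step is a fair coin followed by a step of a stochastic matrix. *)
Lemma lazy_half_lazy delta P :
  lazy_chain (1 / 2) (lazy_chain (2 * delta - 1) P) = lazy_chain delta P.
Proof. by apply/matrixP => x y; rewrite !mxE; field. Qed.

Lemma stationary_lazy delta P mu : mu *m P = mu ->
  mu *m lazy_chain delta P = mu.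
Proof.
move=> muP; rewrite /lazy_chain mulmxDr -!scalemxAr mulmx1 muP -scalerDl.
by rewrite addrC subrK scale1r.
Qed.

Lemma stationaryX P mu m : mu *m P = mu -> mu *m (P ^+ m) = mu.
Proof.
move=> muP; elim: m => [|m IH]; first by rewrite expr0 mulmx1.
by rewrite exprS mulmxA muP.
Qed.

Lemma stationary_act P mu f : mu *m P = mu ->
  \sum_x mu 0 x * act P f x = \sum_x mu 0 x * f x.
Proof.
move=> muP; under eq_bigr do rewrite mulr_sumr.
rewrite exchange_big /=; apply: eq_bigr => y _.
rewrite -[in RHS]muP mxE mulr_suml.
by apply: eq_bigr => x _; rewrite mulrA.
Qed.

End Stochastic.

(** * Total variation distance through events and indicators *)

Section SupTotalVariation.
Variables (R : realType).

Lemma le_sup_range_fin (I : finType) (F : I -> R) (i : I) :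
  F i <= sup (range F).
Proof.
apply: ub_le_sup; last by exists i.
exists (\sum_j `|F j|) => _ [j _ <-].
by rewrite (le_trans (ler_norm _)) // (bigD1 j) //= lerDl sumr_ge0.
Qed.

Lemma sup_range_fin_le (I : finType) (F : I -> R) (i : I) c :
  (forall j, F j <= c) -> sup (range F) <= c.
Proof.
by move=> Fc; apply: ge_sup => [|_ [j _ <-]//]; exists (F i); exists i.
Qed.

Lemma mass_row (n : nat) (A : 'M[R]_n.+1) x (S : {set 'I_n.+1}) :
  mass (row x A) S = act A (fun y => (y \in S)%:R) x.
Proof.
rewrite /mass /act big_mkcond; apply: eq_bigr => y _.
by rewrite mxE; case: ifP => _; rewrite ?mulr1 ?mulr0.
Qed.

Lemma massE (n : nat) (mu : 'rV[R]_n.+1) (S : {set 'I_n.+1}) :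
  mass mu S = \sum_y mu 0 y * (y \in S)%:R.
Proof.
rewrite /mass big_mkcond; apply: eq_bigr => y _.
by case: ifP => _; rewrite ?mulr1 ?mulr0.
Qed.

Lemma le_max_tv_dist (n : nat) (A : 'M[R]_n.+1) mu x (S : {set 'I_n.+1}) :
  mass (row x A) S - mass mu S <= max_tv_dist A mu.
Proof.
apply: le_trans (le_sup_range_fin (fun x => tv_dist (row x A) mu) x).
exact: (le_sup_range_fin (fun S => mass (row x A) S - mass mu S) S).
Qed.

Lemma max_tv_dist_le (n : nat) (A : 'M[R]_n.+1) mu c :
  (forall x (S : {set 'I_n.+1}), mass (row x A) S - mass mu S <= c) ->
  max_tv_dist A mu <= c.
Proof.
move=> H; apply: (sup_range_fin_le ord0) => x.
exact: (sup_range_fin_le finset.set0).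
Qed.

End SupTotalVariation.

(** * Coupling with a stationary copy, and growth of potentials *)

Section Coupling.
Variables (R : realType) (n : nat).
Implicit Types (P : 'M[R]_n.+1) (f : 'I_n.+1 -> R) (mu : 'rV[R]_n.+1).

(** The second copy z is stationary and is kept only on one side of x: [D] will be the strict order
    or its converse. *)
Definition separation (D : rel 'I_n.+1) mu f (x : 'I_n.+1) : R :=
  \sum_(z | D x z) mu 0 z * `|f x - f z|.

Lemma normr_act_sub P f x c : stochastic P ->
  `|act P f x - c| <= act P (fun y => `|f y - c|) x.
Proof.
move=> sP; rewrite -{1}(act_cst c x sP) /act -sumrB.
rewrite (le_trans (ler_norm_sum _ _ _)) //; apply: ler_sum => y _.
by rewrite -mulrBr normrM (ger0_norm (sP.1 _ _)).
Qed.

(* One step of the coupling of two copies of the chain in which a fair coin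
   decides which copy moves (by P); the hypotheses on D say that the copies
   cannot leave the region D without meeting. *)
Lemma separation_step (D : rel 'I_n.+1) P mu f x : stochastic P ->
  (forall i, 0 <= mu 0 i) -> mu *m P = mu ->
  (forall x z x', D x z -> P x x' != 0 -> (x' == z) || D x' z) ->
  (forall x z z', D x z -> P z z' != 0 -> (z' == x) || D x z') ->
  separation D mu (act (lazy_chain (1 / 2) P) f) x
    <= act (lazy_chain (1 / 2) P) (separation D mu f) x.
Proof.
move=> sP mu0 muP Dl Dr; rewrite act_lazy.
(* [A] is the contribution of a move of the first copy, [B] that of the second. *)
pose A := \sum_(z | D x z) mu 0 z * act P (fun x' => `|f x' - f z|) x.
pose B := \sum_(z | D x z) mu 0 z * act P (fun z' => `|f z' - f x|) z.
have -> : 1 - 1 / 2 = 1 / 2 :> R by field.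
have AB : separation D mu (act (lazy_chain (1 / 2) P) f) x
    <= 1 / 2 * A + 1 / 2 * B.
  rewrite -mulrDr -big_split mulr_sumr; apply: ler_sum => z _ /=.
  rewrite -mulrDr mulrCA ler_wpM2l // !act_lazy.
  have -> : 1 / 2 * f x + (1 - 1 / 2) * act P f x
      - (1 / 2 * f z + (1 - 1 / 2) * act P f z) =
    1 / 2 * ((act P f x - f z) - (act P f z - f x)) by field.
  rewrite normrM (ger0_norm (_ : 0 <= 1 / 2)) ?divr_ge0 //.
  rewrite ler_wpM2l ?divr_ge0 // (le_trans (ler_normB _ _)) //.
  by rewrite lerD // normr_act_sub.
apply: le_trans AB _; rewrite addrC lerD // ler_wpM2l ?divr_ge0 //.
- rewrite /B /separation.
  under eq_bigr do rewrite mulr_sumr.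
  rewrite exchange_big /= [leRHS]big_mkcond; apply: ler_sum => z' _.
  case: ifPn => [_|nD].
    (* Dropping the condition on the previous position z only adds nonnegative terms, and the full
       sum over z gives back mu by stationarity. *)
    rewrite -[in leRHS]muP mxE mulr_suml [leLHS]big_mkcond.
    apply: ler_sum => z _; rewrite [`|f x - _|]distrC.
    by case: ifP => _; [rewrite mulrA | rewrite !mulr_ge0 ?sP.1].
  rewrite big1 // => z /Dr xz; have [->|/xz] := eqVneq (P z z') 0.
    by rewrite mul0r mulr0.
  by rewrite (negbTE nD) orbF => /eqP ->; rewrite subrr normr0 !mulr0.
- rewrite /A /separation; under eq_bigr do rewrite mulr_sumr.
  rewrite exchange_big /=; apply: ler_sum => x' _.
  rewrite mulr_sumr big_mkcond [leRHS]big_mkcond; apply: ler_sum => z _.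
  rewrite mulrCA; case: ifPn => [xz|_].
    have [->|Pxx'] := eqVneq (P x x') 0; first by rewrite !mul0r; case: ifP.
    have /orP[/eqP ->|->//] := Dl _ _ _ xz Pxx'.
    by rewrite subrr normr0 !mulr0; case: ifP.
  by case: ifP => _ //; rewrite !mulr_ge0 ?sP.1.
Qed.

(* [E] plays the role of the expected time to reach the states from which the
   region D carries stationary mass at most [eps]. *)
Lemma separation_le (D : rel 'I_n.+1) P mu f E eps m x :
  stochastic P -> is_distribution mu -> mu *m P = mu ->
  (forall x z x', D x z -> P x x' != 0 -> (x' == z) || D x' z) ->
  (forall x z z', D x z -> P z z' != 0 -> (z' == x) || D x z') ->
  (forall y, 0 <= f y <= 1) -> (forall y, 0 <= E y) -> 0 <= eps ->
  (forall y, eps < \sum_(z | D y z) mu 0 z ->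
    act (lazy_chain (1 / 2) P) E y <= E y - 1) ->
  separation D mu (act (lazy_chain (1 / 2) P ^+ m) f) x <= eps + E x / m.+1%:R.
Proof.
set Q := lazy_chain (1 / 2) P.
move=> sP [mu0 mu1] muP Dl Dr f01 E0 eps0 QE.
have sQ : stochastic Q by apply: stochastic_lazy => //; lra.
have sep_mass k y :
    separation D mu (act (Q ^+ k) f) y <= \sum_(z | D y z) mu 0 z.
  apply: ler_sum => z _; rewrite -[leRHS]mulr1 ler_wpM2l //.
  have bnd w := act_itv01 w (stochasticX k sQ) f01.
  rewrite ler_norml; have := bnd y; have := bnd z; lra.
have mass1 y : \sum_(z | D y z) mu 0 z <= 1.
  by rewrite -mu1 [leRHS](bigID (D y)) /= lerDl sumr_ge0.
elim: m x => [|m IH] x; have [lo|hi] := leP (\sum_(z | D x z) mu 0 z) eps.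
- by rewrite (le_trans (sep_mass _ _)) // (le_trans lo) // lerDl divr_ge0.
(* For m = 0, nonnegativity of [act Q E x] and [QE] force [E x >= 1], which covers the trivial bound
   1. *)
- have QE0 : 0 <= act Q E x.
    by apply: sumr_ge0 => y _; rewrite mulr_ge0 ?sQ.1.
  have := QE x hi; have := sep_mass 0%N x; have := mass1 x.
  by rewrite divr1; lra.
- by rewrite (le_trans (sep_mass _ _)) // (le_trans lo) // lerDl divr_ge0.
(* If [E x] exceeds m + 2, the trivial bound 1 suffices; otherwise (E x - 1) / (m + 1) <= E x / (m +
   2), which closes the induction. *)
- have [small|big] := leP (E x) m.+2%:R; last first.
    rewrite (le_trans (sep_mass _ _)) // (le_trans (mass1 _)) //.
    by rewrite (le_trans (_ : 1 <= E x / m.+2%:R)) ?lerDr // ler_pdivlMr ?mul1r // ltW.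
  have step : separation D mu (act (Q ^+ m.+1) f) x
      <= act Q (separation D mu (act (Q ^+ m) f)) x.
    have -> : act (Q ^+ m.+1) f = act Q (act (Q ^+ m) f).
      by apply/funext => y; rewrite actXS.
    exact: separation_step.
  apply: le_trans step _; apply: le_trans (act_le (sQ.1 x) IH) _.
  have -> : (fun y => eps + E y / m.+1%:R)
      = (fun y => (fun=> eps) y + (m.+1%:R)^-1 * E y).
    by apply/funext => y; rewrite mulrC.
  rewrite actD act_cst // actZ lerD2l.
  have Sm : 0 < (m.+1%:R)^-1 :> R by rewrite invr_gt0.
  apply: (@le_trans _ _ ((m.+1%:R)^-1 * (E x - 1))); first by rewrite ler_pM2l // QE.
  rewrite mulrC ler_pdivrMr // mulrAC ler_pdivlMr //.
  by rewrite -[m.+2%:R]natr1; rewrite -natr1 in small *; nra.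
Qed.

(** By stationarity f and [act P f] have the same mean, so the left side is the mu-average of
    [act P f x - act P f y], split by the side of x on which y lies. *)
Lemma act_sub_mean_le P mu f x : is_distribution mu -> mu *m P = mu ->
  act P f x - \sum_y mu 0 y * f y <=
    separation (fun x y => x < y)%N mu (act P f) x
    + separation (fun x y => y < x)%N mu (act P f) x.
Proof.
move=> [mu0 mu1] muP; rewrite -(stationary_act f muP).
rewrite -[X in X - _]mul1r -mu1 mulr_suml -sumrB.
rewrite (bigID (fun y : 'I_n.+1 => (x < y)%N)) /= lerD //.
  apply: ler_sum => y _; rewrite -mulrBr ler_wpM2l //; exact: ler_norm.
rewrite [leLHS]big_mkcond /= [leRHS]big_mkcond /=; apply: ler_sum => y _.
case: ltngtP => //= [_|/val_inj ->]; last by rewrite subrr.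
by rewrite -mulrBr ler_wpM2l // ler_norm.
Qed.

(* If P G <= G + kappa, then 1 + theta G grows at most by the factor
   1 + theta kappa at each step. *)
Lemma actX_exp_moment_le P (G : 'I_n.+1 -> R) kappa theta m x : stochastic P ->
  (forall y, 0 <= G y) -> (forall y, act P G y <= G y + kappa) ->
  0 <= theta -> 0 <= kappa ->
  act (P ^+ m) (fun y => 1 + theta * G y) x
    <= (1 + theta * kappa) ^+ m * (1 + theta * G x).
Proof.
move=> sP G0 PG th0 k0; elim: m x => [|m IH] x; first by rewrite !expr0 act1 mul1r.
rewrite actXS; apply: le_trans (act_le (sP.1 x) IH) _.
have tk0 : 0 <= theta * kappa by rewrite mulr_ge0.
rewrite actZ exprSr -mulrA ler_wpM2l ?exprn_ge0 ?addr_ge0 //.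
have := actD P (fun=> 1) (fun y => theta * G y) x => /= ->.
rewrite act_cst // actZ mulrDl mul1r -addrA lerD2l.
have := ler_wpM2l th0 (PG x); rewrite mulrDr.
have : 0 <= theta * kappa * (theta * G x) by rewrite !mulr_ge0.
lra.
Qed.

End Coupling.

(** * Birth and death chains: generator, positivity, detailed balance *)

Section BirthDeath.
Variables (R : realType) (n : nat) (p q r : 'I_n.+1 -> R).
Hypothesis rates : birth_death_rates p q r.
Let K := birth_death_mx p q r.

(** [f] lives on [nat] so that the neighbours of the end states can be written; the spurious terms
    vanish because p_n = 0 and q_0 = 0. *)
Lemma act_birth_death (f : nat -> R) (x : 'I_n.+1) :
  act K (fun y => f y) x
    = f x + p x * (f x.+1 - f x) + q x * (f x.-1 - f x).
Proof.
have -> : act K (fun y => f y) x =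
    \sum_(y < n.+1 | y == x.+1 :> nat) p x * f y
    + \sum_(y < n.+1 | x == y.+1 :> nat) q x * f y
    + \sum_(y < n.+1 | x == y) r x * f y.
  rewrite big_mkcond [X in _ + X + _]big_mkcond [X in _ + X]big_mkcond -!big_split.
  apply: eq_bigr => y _ /=; rewrite mxE -val_eqE /=.
  have [->|_] := eqVneq (y : nat) x.+1.
    by rewrite !ltn_eqF ?addr0 // ltnS leqnSn.
  have [->|_] := eqVneq (x : nat) y.+1; first by rewrite gtn_eqF // add0r addr0.
  by case: ifP => _; rewrite ?mul0r !add0r.
have -> : \sum_(y < n.+1 | x == y) r x * f y = r x * f x.
  by rewrite (big_pred1 x) // => y; rewrite eq_sym.
have -> : \sum_(y < n.+1 | y == x.+1 :> nat) p x * f y = p x * f x.+1.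
  have [xn|] := ltnP x n.
    by rewrite (big_pred1 (Ordinal (xn : x.+1 < n.+1)%N)).
  move=> nx; have -> : x = ord_max.
    by apply/val_inj/eqP; rewrite /= eqn_leq nx -ltnS ltn_ord.
  by rewrite (birth_last rates) big1 ?mul0r // => *; rewrite mul0r.
have -> : \sum_(y < n.+1 | x == y.+1 :> nat) q x * f y = q x * f x.-1.
  case: (posnP x) => [x0|x0].
    have -> : x = ord0 by apply/val_inj.
    by rewrite (death_first rates) big1 ?mul0r // => *; rewrite mul0r.
  have xn : (x.-1 < n.+1)%N by rewrite (leq_ltn_trans (leq_pred _)).
  rewrite (big_pred1 (Ordinal xn)) // => y /=.
  by rewrite -val_eqE /= -{1}(prednK x0) eqSS eq_sym.
by have := rates_sum1 rates x; nra.
Qed.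

Lemma stochastic_birth_death : stochastic K.
Proof.
split=> [x y|x].
  rewrite mxE; case: ifP => _; first exact: birth_ge0 rates x.
  case: ifP => _; first exact: death_ge0 rates x.
  by case: ifP => _ //; exact: hold_ge0 rates x.
by rewrite -act_one (act_birth_death (fun=> 1)) !subrr !mulr0 !addr0.
Qed.

Lemma lazy_birth_death_nearest delta (x y : 'I_n.+1) :
  lazy_chain delta K x y != 0 -> (x <= y.+1)%N && (y <= x.+1)%N.
Proof.
rewrite !mxE; have [->|xy] := eqVneq x y; first by rewrite leqnSn.
rewrite mulr0 add0r; have [->|_] := eqVneq (y : nat) x.+1.
  by rewrite leqnn (leq_trans (leqnSn _)).
have [->|_] := eqVneq (x : nat) y.+1; last by rewrite mulr0 eqxx.
by rewrite leqnn (leq_trans (leqnSn _)).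
Qed.

Hypothesis irr : irreducible_chain K.

(** If p_k = 0, the set [0,k] is closed: by induction on m, [K ^+ m] never leads from it to
    [ord_max], against irreducibility. *)
Lemma birth_gt0 (k : 'I_n.+1) : (k < n)%N -> 0 < p k.
Proof.
move=> kn; rewrite lt_def (birth_ge0 rates) andbT; apply/eqP => pk0.
have [m] := irr k ord_max; apply/negP; rewrite -leNgt.
suff H (x : 'I_n.+1) : (x <= k)%N -> (K ^+ m) x ord_max = 0 by rewrite H.
have -> : (K ^+ m) x ord_max = act (K ^+ m) (fun y => (y == n :> nat)%:R) x.
  rewrite /act (bigD1 ord_max) //= eqxx mulr1 big1 ?addr0 // => y.
  by rewrite -val_eqE /= => /negbTE ->; rewrite mulr0.
elim: m x => [|m IH] x xk; first by rewrite act1 ltn_eqF // (leq_ltn_trans xk).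
rewrite actXS /act big1 // => y _.
have [yk|ky] := leqP y k; first by rewrite -/(act _ _ _) IH // mulr0.
rewrite mxE; have [yx|yx] := eqVneq (y : nat) x.+1.
  have -> : x = k by apply/val_inj/eqP; rewrite eqn_leq xk -ltnS -yx.
  by rewrite pk0 mul0r.
rewrite !ifF ?mul0r //; apply/negP.
  by move=> /eqP xy; rewrite xy in xk; move: (leq_ltn_trans xk ky); rewrite ltnn.
move=> /eqP xy; have : (x < y)%N by rewrite (leq_ltn_trans xk ky).
by rewrite xy ltnNge leqnSn.
Qed.

Lemma death_gt0 (k : 'I_n.+1) : (0 < k)%N -> 0 < q k.
Proof.
move=> k0; rewrite lt_def (death_ge0 rates) andbT; apply/eqP => qk0.
have [m] := irr k ord0; apply/negP; rewrite -leNgt.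
suff H (x : 'I_n.+1) : (k <= x)%N -> (K ^+ m) x ord0 = 0 by rewrite H.
have -> : (K ^+ m) x ord0 = act (K ^+ m) (fun y => (y == 0 :> nat)%:R) x.
  rewrite /act (bigD1 ord0) //= mulr1 big1 ?addr0 // => y.
  by rewrite -val_eqE /= => /negbTE ->; rewrite mulr0.
elim: m x => [|m IH] x kx; first by rewrite act1 gtn_eqF // (leq_trans k0).
rewrite actXS /act big1 // => y _.
have [ky|yk] := leqP k y; first by rewrite -/(act _ _ _) IH // mulr0.
rewrite mxE; have yx := leq_trans yk kx.
rewrite ifF; last by rewrite ltn_eqF // ltnW.
have [xy|xy] := eqVneq (x : nat) y.+1.
  have -> : x = k by apply/val_inj/eqP; rewrite /= eqn_leq kx xy yk.
  by rewrite qk0 mul0r.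
by rewrite ifF ?mul0r // -val_eqE /= gtn_eqF.
Qed.

Variable mu : 'rV[R]_n.+1.
Hypothesis mu_st : stationary_distribution K mu.

(** Some state carries mass, irreducibility sends part of it to y, and mu is invariant under every
    power of [K]. *)
Lemma stationary_gt0 (y : 'I_n.+1) : 0 < mu 0 y.
Proof.
have [[mu0 mu1] muK] := mu_st.
have [x mux] : exists x, 0 < mu 0 x.
  apply/existsP; apply: contraTT isT; rewrite negb_exists => /forallP H.
  have : \sum_i mu 0 i <= 0.
    by apply: sumr_le0 => i _; rewrite leNgt H.
  by rewrite mu1 ler10.
have [m Km] := irr x y.
rewrite -(stationaryX m muK) mxE (bigD1 x) //= ltr_pwDl ?mulr_gt0 //.
apply: sumr_ge0 => z _; rewrite mulr_ge0 //.
exact: (stochasticX m stochastic_birth_death).1.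
Qed.

(** Stationarity tested against the indicator of [0,k] says that the net flow across the edge
    between k and k + 1 is zero. *)
Lemma detailed_balance (k l : 'I_n.+1) : l = k.+1 :> nat ->
  mu 0 k * p k = mu 0 l * q l.
Proof.
move=> lk; have [[mu0 mu1] muK] := mu_st.
pose f (m : nat) : R := (m <= k)%N%:R.
have kl : (k == l) = false by rewrite -val_eqE /= lk ltn_eqF.
have : \sum_y mu 0 y * (p y * (f y.+1 - f y) + q y * (f y.-1 - f y)) = 0.
  rewrite -[RHS](subrr (\sum_y mu 0 y * f y)).
  rewrite -{1}(stationary_act (fun y : 'I_n.+1 => f y) muK) -sumrB.
  by apply: eq_bigr => y _; rewrite act_birth_death; ring.
rewrite (bigD1 k) //= (bigD1 l) ?[l == k]eq_sym ?kl //= big1 => [|y].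
  by rewrite /f lk /= leqnn !ltnn leq_pred ltnNge leqnSn /=; lra.
rewrite -!val_eqE /= lk => /andP[yk yl]; rewrite /f ltn_neqAle yk /=.
have [ylek|ky] := leqP y k.
  by rewrite (leq_trans (leq_pred _) ylek) /=; ring.
have y0 : (0 < y)%N by rewrite (leq_ltn_trans _ ky).
rewrite -ltnS prednK // [(y <= _)%N]leq_eqVlt (negbTE yl) ltnS leqNgt ky /=.
by rewrite !subrr !mulr0 addr0 mulr0.
Qed.

End BirthDeath.

(** * Expected hitting times as potentials *)

Section HittingTimes.
Variables (R : realType) (n : nat) (p q r : 'I_n.+1 -> R).
Hypothesis rates : birth_death_rates p q r.
Let K := birth_death_mx p q r.
Hypothesis irr : irreducible_chain K.
Variable mu : 'rV[R]_n.+1.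
Hypothesis mu_st : stationary_distribution K mu.

Lemma mass_lower (x : 'I_n.+1) :
  mass mu (states n 0 x) = \sum_(j < n.+1 | (j < x)%N) mu 0 j + mu 0 x.
Proof.
rewrite /mass (bigD1 x) ?inE //= addrC; congr (_ + _); apply: eq_bigl => j.
by rewrite !inE /= ltn_neqAle andbC.
Qed.

Lemma mass_upper (x : 'I_n.+1) :
  mass mu (states n x n) = \sum_(j < n.+1 | (x < j)%N) mu 0 j + mu 0 x.
Proof.
have lt_n (j : 'I_n.+1) : (j <= n)%N by rewrite -ltnS.
rewrite /mass (bigD1 x) ?inE ?leqnn ?lt_n //= addrC; congr (_ + _).
apply: eq_bigl => j; rewrite !inE /= lt_n andbT.
by rewrite ltn_neqAle andbC eq_sym.
Qed.

(* With U = {k | k < a} and x <= a, [ascent U x] is the expected time the chain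
   takes from 0 to x; symmetrically for [descent] and n. *)
Definition ascent (U : pred 'I_n.+1) (m : nat) : R :=
  \sum_(k < n.+1 | (k < m)%N && U k) mass mu (states n 0 k) / (mu 0 k * p k).

Definition descent (V : pred 'I_n.+1) (m : nat) : R :=
  \sum_(k < n.+1 | (m < k)%N && V k) mass mu (states n k n) / (mu 0 k * q k).

Lemma mass_ge0 S : 0 <= mass mu S.
Proof. by have [[mu0 _] _] := mu_st; apply: sumr_ge0. Qed.

Lemma ascent_term_ge0 (k : 'I_n.+1) :
  0 <= mass mu (states n 0 k) / (mu 0 k * p k).
Proof.
have [[mu0 _] _] := mu_st.
by rewrite divr_ge0 ?mass_ge0 ?mulr_ge0 // (birth_ge0 rates).
Qed.

Lemma descent_term_ge0 (k : 'I_n.+1) :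
  0 <= mass mu (states n k n) / (mu 0 k * q k).
Proof.
have [[mu0 _] _] := mu_st.
by rewrite divr_ge0 ?mass_ge0 ?mulr_ge0 // (death_ge0 rates).
Qed.

Lemma ascent_ge0 U m : 0 <= ascent U m.
Proof. by apply: sumr_ge0 => k _; exact: ascent_term_ge0. Qed.

Lemma descent_ge0 V m : 0 <= descent V m.
Proof. by apply: sumr_ge0 => k _; exact: descent_term_ge0. Qed.

Lemma ascentS U (x : 'I_n.+1) :
  ascent U x.+1 = ascent U x
    + (if U x then mass mu (states n 0 x) / (mu 0 x * p x) else 0).
Proof.
rewrite /ascent big_mkcond (bigD1 x) //= ltnSn addrC; congr (_ + _).
rewrite [RHS]big_mkcond [RHS](bigD1 x) //= ltnn add0r; apply: eq_bigr => k.
by rewrite -val_eqE ltnS [(k <= x)%N]leq_eqVlt /= => /negbTE ->.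
Qed.

Lemma descentS V (x : 'I_n.+1) : (0 < x)%N ->
  descent V x.-1 = descent V x
    + (if V x then mass mu (states n x n) / (mu 0 x * q x) else 0).
Proof.
move=> x0; rewrite /descent big_mkcond (bigD1 x) //= prednK // leqnn addrC.
congr (_ + _); rewrite [RHS]big_mkcond [RHS](bigD1 x) //= ltnn add0r.
apply: eq_bigr => k.
by rewrite -val_eqE /= [(x <= k)%N]leq_eqVlt eq_sym => /negbTE ->.
Qed.

(** For x in [U] the upward increment contributes pi([0,x]) / pi(x) and, by detailed balance, the
    downward one -pi([0,x-1]) / pi(x); they add up to 1. Off [U] the upward term is 0 and the
    downward one nonpositive. [U] is an initial segment so that it contains x - 1 along with x. *)
Lemma act_ascent (U : pred 'I_n.+1) (x : 'I_n.+1) :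
  (forall i j : 'I_n.+1, (i <= j)%N -> U j -> U i) ->
  (forall i : 'I_n.+1, U i -> (i < n)%N) ->
  (U x -> act K (fun y => ascent U y) x = ascent U x + 1)
  /\ act K (fun y => ascent U y) x <= ascent U x + 1.
Proof.
move=> Udown Un; rewrite act_birth_death // ascentS.
have mu_gt0 := stationary_gt0 rates irr mu_st.
set up := p x * _; set down := q x * _.
have upE : up = if U x then mass mu (states n 0 x) / mu 0 x else 0.
  rewrite /up addrC addKr; case: ifPn => [Ux|_]; last by rewrite mulr0.
  have px := birth_gt0 rates irr (Un _ Ux).
  by field; rewrite !lt0r_neq0.
have [down0 downE] : down <= 0 /\ (U x -> down = 1 - mass mu (states n 0 x) / mu 0 x).
  rewrite /down; have [x0|x0] := posnP x.
    have -> : x = ord0 by apply/val_inj.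
    rewrite (death_first rates) mul0r mass_lower big1 //.
    by split=> // _; rewrite add0r divff ?subrr // lt0r_neq0.
  have xn : (x.-1 < n.+1)%N by rewrite (leq_ltn_trans (leq_pred _)).
  pose i := Ordinal xn; have xi : x = i.+1 :> nat by rewrite prednK.
  have pi_gt0 : 0 < p i by rewrite (birth_gt0 rates irr) // -xi -ltnS.
  have qx_gt0 := death_gt0 rates irr x0.
  have balance := detailed_balance rates mu_st xi.
  have -> : q x * (ascent U x.-1 - ascent U x)
      = if U i then - (mass mu (states n 0 i) / mu 0 x) else 0.
    rewrite {2}xi -[x.-1]/(i : nat) ascentS opprD addNKr.
    case: ifP => _; last by rewrite oppr0 mulr0.
    by rewrite balance; field; rewrite !lt0r_neq0.
  split=> [|Ux]; first by case: ifP => // _; rewrite oppr_le0 divr_ge0 ?mass_ge0 // ltW.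
  rewrite (Udown i x) ?leq_pred // [mass mu (states n 0 x)]mass_lower.
  have -> : \sum_(j < n.+1 | (j < x)%N) mu 0 j = mass mu (states n 0 i).
    by apply: eq_bigl => j; rewrite !inE xi ltnS.
  by field; rewrite lt0r_neq0.
split=> [Ux|]; first by rewrite upE Ux downE //; ring.
rewrite -addrA lerD2l upE; case: ifP => [Ux|_]; last by rewrite add0r (le_trans down0).
by rewrite downE // addrC subrK.
Qed.

(** Mirror image of [act_ascent] with a final segment: the increments at x are pi([x,n]) / pi(x) and
    -pi([x+1,n]) / pi(x). *)
Lemma act_descent (V : pred 'I_n.+1) (x : 'I_n.+1) :
  (forall i j : 'I_n.+1, (i <= j)%N -> V i -> V j) ->
  (forall i : 'I_n.+1, V i -> (0 < i)%N) ->
  (V x -> act K (fun y => descent V y) x = descent V x + 1)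
  /\ act K (fun y => descent V y) x <= descent V x + 1.
Proof.
move=> Vup V0; rewrite act_birth_death // addrAC.
have mu_gt0 := stationary_gt0 rates irr mu_st.
set up := p x * _; set down := q x * _.
have downE : down = if V x then mass mu (states n x n) / mu 0 x else 0.
  rewrite /down; have [x0|x0] := posnP x.
    rewrite ifF; last by apply/negP => /V0; rewrite x0.
    by rewrite x0 subrr mulr0.
  rewrite descentS // addrC addKr; case: ifPn => [Vx|_]; last by rewrite mulr0.
  have qx := death_gt0 rates irr x0.
  by field; rewrite !lt0r_neq0.
have [up0 upE] : up <= 0 /\ (V x -> up = 1 - mass mu (states n x n) / mu 0 x).
  rewrite /up; have [xn|xn] := ltnP x n; last first.
    have -> : x = ord_max by apply/val_inj/eqP; rewrite eqn_leq xn -ltnS ltn_ord.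
    rewrite (birth_last rates) mul0r mass_upper big1 => [|j]; last first.
      by rewrite /= ltnNge -ltnS ltn_ord.
    by split=> // _; rewrite add0r divff ?subrr // lt0r_neq0.
  pose i := Ordinal (xn : (x.+1 < n.+1)%N); have ix : i = x.+1 :> nat by [].
  have px_gt0 := birth_gt0 rates irr xn.
  have qi_gt0 : 0 < q i by rewrite (death_gt0 rates irr).
  have balance := detailed_balance rates mu_st ix.
  have -> : p x * (descent V x.+1 - descent V x)
      = if V i then - (mass mu (states n i n) / mu 0 x) else 0.
    rewrite -[X in _ * (_ - descent V X)]/(i.-1 : nat) descentS // opprD addNKr.
    case: ifP => _; last by rewrite oppr0 mulr0.
    by rewrite -balance; field; rewrite !lt0r_neq0.
  split=> [|Vx]; first by case: ifP => // _; rewrite oppr_le0 divr_ge0 ?mass_ge0 // ltW.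
  rewrite (Vup x i) ?leqnSn // [mass mu (states n x n)]mass_upper.
  have -> : \sum_(j < n.+1 | (x < j)%N) mu 0 j = mass mu (states n i n).
    by apply: eq_bigl => j; rewrite !inE /= -[(j <= n)%N]ltnS ltn_ord andbT.
  by field; rewrite lt0r_neq0.
split=> [Vx|]; first by rewrite downE Vx upE //; ring.
rewrite -addrA lerD2l downE; case: ifP => [Vx|_]; last by rewrite add0r (le_trans up0).
by rewrite upE // addrC subrK.
Qed.

End HittingTimes.

(** * Upper bound for the lazy chain *)

Section UpperBound.
Variables (R : realType) (n : nat) (p q r : 'I_n.+1 -> R).
Hypothesis rates : birth_death_rates p q r.
Let K := birth_death_mx p q r.
Hypothesis irr : irreducible_chain K.
Variable mu : 'rV[R]_n.+1.
Hypothesis mu_st : stationary_distribution K mu.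

Lemma mass_le1 S : mass mu S <= 1.
Proof.
have [[mu0 mu1] _] := mu_st.
by rewrite -mu1 [leRHS](bigID (mem S)) /= lerDl sumr_ge0.
Qed.

Section Tails.
Variable eps : R.
Hypothesis eps0 : 0 < eps.

(** [U] is an initial and [V] a final segment. From x in [U], the expected time for [K] to leave [U]
    is [ascent p mu U n - ascent p mu U x]; similarly for [V] with [descent]. *)
Let U (x : 'I_n.+1) : bool := eps < \sum_(z : 'I_n.+1 | (x < z)%N) mu 0 z.
Let V (x : 'I_n.+1) : bool := eps < \sum_(z : 'I_n.+1 | (z < x)%N) mu 0 z.

Lemma upper_tail_down (i j : 'I_n.+1) : (i <= j)%N -> U j -> U i.
Proof.
have [[mu0 _] _] := mu_st.
move=> ij /lt_le_trans; apply; rewrite big_mkcond [leRHS]big_mkcond.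
apply: ler_sum => z _; case: ifP => [jz|_]; last by case: ifP.
by rewrite (leq_ltn_trans ij jz).
Qed.

Lemma lower_tail_up (i j : 'I_n.+1) : (i <= j)%N -> V i -> V j.
Proof.
have [[mu0 _] _] := mu_st.
move=> ij /lt_le_trans; apply; rewrite big_mkcond [leRHS]big_mkcond.
apply: ler_sum => z _; case: ifP => [zi|_]; last by case: ifP.
by rewrite (leq_trans zi ij).
Qed.

Lemma upper_tail_lt (i : 'I_n.+1) : U i -> (i < n)%N.
Proof.
apply: contraTltn => ni; rewrite -leNgt big1 ?ltW // => z.
by rewrite ltnNge (leq_trans _ ni) // -ltnS.
Qed.

Lemma lower_tail_gt (i : 'I_n.+1) : V i -> (0 < i)%N.
Proof.
by apply: contraTltn; rewrite leqn0 => /eqP i0; rewrite -leNgt big1 ?ltW // i0.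
Qed.

(** The denominators agree by detailed balance, while pi([0,k]) <= 1 and, as k is in [U],
    pi([k+1,n]) > eps. *)
Lemma ascent_term_le (k l : 'I_n.+1) : l = k.+1 :> nat -> U k ->
  mass mu (states n 0 k) / (mu 0 k * p k)
    <= mass mu (states n l n) / (mu 0 l * q l) / eps.
Proof.
move=> lk Uk; rewrite (detailed_balance rates mu_st lk) mulrAC.
have l0 : (0 < l)%N by rewrite lk.
have d0 : 0 < mu 0 l * q l.
  by rewrite mulr_gt0 ?(stationary_gt0 rates irr mu_st) ?(death_gt0 rates irr).
rewrite ler_pM2r ?invr_gt0 // (le_trans (mass_le1 _)) // ler_pdivlMr // mul1r.
apply: le_trans (ltW Uk) _; rewrite le_eqVlt; apply/orP; left; apply/eqP.
by apply: eq_bigl => j; rewrite !inE lk -[(j <= n)%N]ltnS ltn_ord andbT.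
Qed.

Lemma descent_term_le (k l : 'I_n.+1) : l = k.+1 :> nat -> V l ->
  mass mu (states n l n) / (mu 0 l * q l)
    <= mass mu (states n 0 k) / (mu 0 k * p k) / eps.
Proof.
move=> lk Vl; rewrite (detailed_balance rates mu_st lk) [leRHS]mulrAC.
have l0 : (0 < l)%N by rewrite lk.
have d0 : 0 < mu 0 l * q l.
  by rewrite mulr_gt0 ?(stationary_gt0 rates irr mu_st) ?(death_gt0 rates irr).
rewrite ler_pM2r ?invr_gt0 // (le_trans (mass_le1 _)) // ler_pdivlMr // mul1r.
apply: le_trans (ltW Vl) _; rewrite le_eqVlt; apply/orP; left; apply/eqP.
by apply: eq_bigl => j; rewrite !inE lk ltnS.
Qed.

Let c (k : 'I_n.+1) := mass mu (states n 0 k) / (mu 0 k * p k).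
Let d (k : 'I_n.+1) := mass mu (states n k n) / (mu 0 k * q k).

(** Terms from x up to i0 belong to the first sum, and there are none unless x < i0. From i0 on,
    [ascent_term_le] compares each term with the next one of the second sum. *)
Lemma ascent_tail_le (i0 x : 'I_n.+1) :
  ascent p mu U n - ascent p mu U x <=
    (if (x < i0)%N then \sum_(k < n.+1 | (k < i0)%N) c k else 0)
    + (\sum_(k < n.+1 | (i0 < k)%N) d k) / eps.
Proof.
have c0 k : 0 <= c k := ascent_term_ge0 rates mu_st k.
have d0 k : 0 <= d k := descent_term_ge0 rates mu_st k.
have low : \sum_(k < n.+1 | (x <= k < i0)%N) c k
    <= if (x < i0)%N then \sum_(k < n.+1 | (k < i0)%N) c k else 0.
  case: ifPn => xi0.
    rewrite big_mkcond [leRHS]big_mkcond; apply: ler_sum => k _.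
    by case: ifP => [/andP[_ ->//]|_]; case: ifP.
  rewrite big1 // => k /andP[xk ki]; case/negP: xi0; exact: leq_ltn_trans ki.
have high : \sum_(k < n.+1 | [&& (i0 <= k)%N, (k < n)%N & U k]) c k
    <= (\sum_(k < n.+1 | (i0 < k)%N) d k) / eps.
  rewrite mulr_suml big_mkcond [leRHS]big_mkcond.
  (* Shift by one: index k on the left meets k + 1 on the right; the leftover terms k = n on the
     left and k = 0 on the right vanish. *)
  rewrite big_ord_recr [leRHS]big_ord_recl /= ltnn andbF /= addr0 add0r.
  apply: ler_sum => k _; rewrite /= /bump leq0n add1n ltnS.
  case: ifP => [/and3P[-> _ Uk]|_]; first by apply: ascent_term_le; rewrite //= /bump.
  by case: ifP => // _; rewrite divr_ge0 // ltW.
apply: le_trans (lerD low high).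
rewrite lerBlDr /ascent big_mkcond [X in _ <= X + _ + _]big_mkcond.
rewrite [X in _ <= _ + X + _]big_mkcond [X in _ <= _ + _ + X]big_mkcond.
rewrite -!big_split; apply: ler_sum => k _ /=; rewrite -/(c k).
have := c0 k; case: (ltnP k n) => //= kn; case: (ltnP k x) => /= kx;
  case: (ltnP k i0) => /= ki; case: (U k) => /=; lra.
Qed.

Lemma descent_tail_le (i0 x : 'I_n.+1) :
  descent q mu V 0 - descent q mu V x <=
    (if (i0 < x)%N then \sum_(k < n.+1 | (i0 < k)%N) d k else 0)
    + (\sum_(k < n.+1 | (k < i0)%N) c k) / eps.
Proof.
have c0 k : 0 <= c k := ascent_term_ge0 rates mu_st k.
have d0 k : 0 <= d k := descent_term_ge0 rates mu_st k.
have high : \sum_(k < n.+1 | (i0 < k <= x)%N) d k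
    <= if (i0 < x)%N then \sum_(k < n.+1 | (i0 < k)%N) d k else 0.
  case: ifPn => xi0.
    rewrite big_mkcond [leRHS]big_mkcond; apply: ler_sum => k _.
    by case: ifP => [/andP[->//]|_]; case: ifP.
  rewrite big1 // => k /andP[ki kx]; case/negP: xi0; exact: leq_trans kx.
have low : \sum_(k < n.+1 | [&& (k <= i0)%N, (0 < k)%N & V k]) d k
    <= (\sum_(k < n.+1 | (k < i0)%N) c k) / eps.
  rewrite mulr_suml big_mkcond [leRHS]big_mkcond.
  rewrite big_ord_recl [leRHS]big_ord_recr /= add0r -[leLHS]addr0 lerD //.
    apply: ler_sum => k _; rewrite /= /bump leq0n add1n.
    case: ifP => [/andP[-> Vk]|_]; first by apply: descent_term_le; rewrite //= /bump.
    by case: ifP => // _; rewrite divr_ge0 // ltW.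
  by case: ifP => // _; rewrite divr_ge0 // ltW.
apply: le_trans (lerD high low).
rewrite lerBlDr /descent big_mkcond [X in _ <= X + _ + _]big_mkcond.
rewrite [X in _ <= _ + X + _]big_mkcond [X in _ <= _ + _ + X]big_mkcond.
rewrite -!big_split; apply: ler_sum => k _ /=; rewrite -/(d k).
have := d0 k; case: (ltnP 0 k) => //= kn; case: (ltnP x k) => /= kx;
  case: (ltnP i0 k) => /= ki; case: (V k) => /=; lra.
Qed.

(** [separation_le] is applied on each side of x, whence [2 * eps]. Dividing the hitting times of
    [K] by 1 - delta makes their drift under the lazy chain exactly -1. *)
Lemma lazy_expectation_le delta (i0 x : 'I_n.+1) (f : 'I_n.+1 -> R) m :
  1 / 2 <= delta < 1 -> (forall y, 0 <= f y <= 1) ->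
  act (lazy_chain delta K ^+ m) f x - \sum_y mu 0 y * f y <=
    2 * eps + (1 + 2 / eps) * hitting_sum p q mu i0 / ((1 - delta) * m.+1%:R).
Proof.
move=> /andP[d_ge d_lt] f01.
have [[mu0 mu1] muK] := mu_st.
have sK := stochastic_birth_death rates.
pose P := lazy_chain (2 * delta - 1) K.
have sP : stochastic P by apply: stochastic_lazy => //; lra.
have muP : mu *m P = mu by exact: stationary_lazy.
have QE : lazy_chain delta K = lazy_chain (1 / 2) P by rewrite lazy_half_lazy.
have d1 : 0 < 1 - delta by lra.
have d1V : 0 <= (1 - delta)^-1 by rewrite invr_ge0 ltW.
have muQm : mu *m lazy_chain delta K ^+ m = mu by exact/stationaryX/stationary_lazy.
apply: le_trans (act_sub_mean_le f x mu_st.1 muQm) _.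
(* Steps of [P] have length at most one, so a copy moving alone cannot jump over the other. *)
have near x' y : P x' y != 0 -> (x' <= y.+1)%N && (y <= x'.+1)%N.
  exact: lazy_birth_death_nearest.
pose EU y := (1 - delta)^-1 * (ascent p mu U n - ascent p mu U y).
pose EV y := (1 - delta)^-1 * (descent q mu V 0 - descent q mu V y).
have drift (g : 'I_n.+1 -> R) b y : act K g y = g y + 1 ->
    act (lazy_chain delta K) (fun z => (1 - delta)^-1 * (b - g z)) y
      = (1 - delta)^-1 * (b - g y) - 1.
  move=> gy; rewrite act_lazy actZ.
  have -> : act K (fun z => b - g z) y = b - act K g y.
    rewrite -{2}(act_cst b y sK) -mulN1r -actZ -actD.
    by apply: eq_bigr => z _; rewrite mulN1r.
  by rewrite gy; field; rewrite lt0r_neq0.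
have boundU : separation (fun x y => x < y)%N mu (act (lazy_chain delta K ^+ m) f) x
    <= eps + EU x / m.+1%:R.
  rewrite QE; apply: (@separation_le _ _ _ P mu f EU eps m x) => //.
  - move=> x' z y xz /near /andP[_ yx].
    by rewrite -val_eqE -leq_eqVlt (leq_trans yx).
  - move=> x' z y xz /near /andP[zy _].
    by rewrite -val_eqE eq_sym -leq_eqVlt -ltnS (leq_trans xz).
  - move=> y; rewrite mulr_ge0 // subr_ge0.
    rewrite /ascent big_mkcond [leRHS]big_mkcond; apply: ler_sum => k _.
    case: ifP => [/andP[ky ->]|_].
      by rewrite (leq_trans ky) // -ltnS.
    by case: ifP => // _; exact: (ascent_term_ge0 rates mu_st).
  - exact: ltW.
  move=> y Uy; rewrite -QE drift //.
  exact: (act_ascent rates irr mu_st _ upper_tail_down upper_tail_lt).1.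
have boundV : separation (fun x y => y < x)%N mu (act (lazy_chain delta K ^+ m) f) x
    <= eps + EV x / m.+1%:R.
  rewrite QE; apply: (@separation_le _ _ _ P mu f EV eps m x) => //.
  - move=> x' z y xz /near /andP[yx _].
    by rewrite -val_eqE eq_sym -leq_eqVlt -ltnS (leq_trans xz).
  - move=> x' z y xz /near /andP[_ zy].
    by rewrite -val_eqE -leq_eqVlt (leq_trans zy).
  - move=> y; rewrite mulr_ge0 // subr_ge0.
    rewrite /descent big_mkcond [leRHS]big_mkcond; apply: ler_sum => k _.
    case: ifP => [/andP[ky ->]|_].
      by rewrite (leq_ltn_trans _ ky).
    by case: ifP => // _; exact: (descent_term_ge0 rates mu_st).
  - exact: ltW.
  move=> y Vy; rewrite -QE drift //.
  exact: (act_descent rates irr mu_st _ lower_tail_up lower_tail_gt).1.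
apply: le_trans (lerD boundU boundV) _.
have -> : eps + EU x / m.+1%:R + (eps + EV x / m.+1%:R) = 2 * eps
    + (ascent p mu U n - ascent p mu U x + (descent q mu V 0 - descent q mu V x))
      / ((1 - delta) * m.+1%:R).
  by move: (m.+1%:R) (ltr0Sn R m) => M M0; rewrite /EU /EV; field; rewrite !lt0r_neq0.
rewrite lerD2l ler_pM2r ?invr_gt0 ?mulr_gt0 //.
apply: le_trans (lerD (ascent_tail_le i0 x) (descent_tail_le i0 x)) _.
rewrite -/c -/d /hitting_sum.
set TL := \sum_(k < n.+1 | (k < i0)%N) _; set TR := \sum_(k < n.+1 | (i0 < k)%N) _.
have TL0 : 0 <= TL by apply: sumr_ge0 => k _; exact: (ascent_term_ge0 rates mu_st).
have TR0 : 0 <= TR by apply: sumr_ge0 => k _; exact: (descent_term_ge0 rates mu_st).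
set T := Num.max TL TR.
have TLT : TL <= T by rewrite le_max lexx.
have TRT : TR <= T by rewrite le_max lexx orbT.
have e0 : 0 < eps^-1 by rewrite invr_gt0.
have : 0 <= (T - TL) * eps^-1 by rewrite mulr_ge0 ?subr_ge0 // ltW.
have : 0 <= (T - TR) * eps^-1 by rewrite mulr_ge0 ?subr_ge0 // ltW.
(* At most one of x < i0 and i0 < x holds, so only one of [TL] and [TR] occurs without the factor 1
   / eps: the coefficient is 1 + 2 / eps rather than 2 + 2 / eps. *)
by case: (ltngtP x i0) => _; lra.
Qed.

End Tails.
End UpperBound.

(** * The semigroup as a Poisson mixture of powers *)

Section Poissonization.
Variables (R : realType) (n : nat).
Implicit Types (K : 'M[R]_n.+1) (f : 'I_n.+1 -> R) (s t : R).

Definition poisson t (i : nat) : R := expR (- t) * t ^+ i / i`!%:R.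

Lemma poisson_ge0 t i : 0 <= t -> 0 <= poisson t i.
Proof. by move=> t0; rewrite !mulr_ge0 ?expR_ge0 ?exprn_ge0. Qed.

Lemma sum_exp_coeff_cvg t : \sum_(i < N) t ^+ i / i`!%:R @[N --> \oo] --> expR t.
Proof.
have -> : (fun N => \sum_(i < N) t ^+ i / i`!%:R) = series (exp_coeff t).
  by apply/funext => N; rewrite /series /= big_mkord.
exact: is_cvg_series_exp_coeff.
Qed.

Lemma sum_poisson_cvg s t : \sum_(i < N) poisson t i * s ^+ i @[N --> \oo]
  --> expR (t * (s - 1)).
Proof.
have -> : expR (t * (s - 1)) = expR (- t) * expR (t * s).
  by rewrite -expRD; congr expR; ring.
have -> : (fun N => \sum_(i < N) poisson t i * s ^+ i)
    = (fun N => expR (- t) * \sum_(i < N) (t * s) ^+ i / i`!%:R).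
  apply/funext => N; rewrite mulr_sumr; apply: eq_bigr => i _.
  by rewrite /poisson exprMn; ring.
apply: cvgMl_tmp; exact: sum_exp_coeff_cvg.
Qed.

Lemma sum_poisson1_cvg t : \sum_(i < N) poisson t i @[N --> \oo] --> (1 : R).
Proof.
have -> : (fun N => \sum_(i < N) poisson t i)
    = (fun N => \sum_(i < N) poisson t i * 1 ^+ i).
  by apply/funext => N; apply: eq_bigr => i _; rewrite expr1n mulr1.
have {2}<- : expR (t * (1 - 1)) = 1 :> R by rewrite subrr mulr0 expR0.
exact: sum_poisson_cvg.
Qed.

Lemma sum_poisson_le1 t N : 0 <= t -> \sum_(i < N) poisson t i <= 1.
Proof.
move=> t0.
have nd : nondecreasing_seq (fun N => \sum_(i < N) poisson t i).
  apply/nondecreasing_seqP => m.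
  by rewrite big_ord_recr /= lerDl poisson_ge0.
have := nondecreasing_cvgn_le nd (cvgP _ (@sum_poisson1_cvg t)) N.
by rewrite (cvg_lim _ (@sum_poisson1_cvg t)).
Qed.

(** The [limn] defining [semigroup] is a genuine sum only once convergence is known; comparison with
    the Poisson weights gives it, as the entries of [K ^+ i] lie in [0,1]. *)
Lemma act_semigroup_cvg K t f x : stochastic K -> 0 <= t ->
  \sum_(i < N) poisson t i * act (K ^+ i) f x @[N --> \oo]
    --> act (semigroup K t) f x.
Proof.
move=> sK t0.
have entry y : \sum_(i < N) poisson t i * (K ^+ i) x y @[N --> \oo]
    --> semigroup K t x y.
  rewrite mxE.
  have seriesE : series (fun i => expR (- t) * t ^+ i * (K ^+ i) x y / i`!%:R)
      = (fun N => \sum_(i < N) poisson t i * (K ^+ i) x y).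
    apply/funext => N; rewrite /series /= big_mkord; apply: eq_bigr => i _.
    by rewrite /poisson mulrAC.
  rewrite -seriesE.
  apply: (@series_le_cvg _ _ (poisson t)) => [i|i|i|].
  - rewrite mulrAC mulr_ge0 ?poisson_ge0 //; exact: (stochasticX i sK).1.
  - exact: poisson_ge0.
  - rewrite mulrAC ler_piMr ?poisson_ge0 //.
    have [K0 K1] := stochasticX i sK.
    by rewrite -(K1 x) (bigD1 y) //= lerDl sumr_ge0.
  - have -> : series (poisson t) = (fun N => \sum_(i < N) poisson t i).
      by apply/funext => N; rewrite /series /= big_mkord.
    exact: cvgP (@sum_poisson1_cvg t).
have -> : (fun N => \sum_(i < N) poisson t i * act (K ^+ i) f x)
    = (fun N => \sum_y (\sum_(i < N) poisson t i * (K ^+ i) x y) * f y).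
  apply/funext => N; under [RHS]eq_bigr do rewrite mulr_suml.
  rewrite exchange_big /=; apply: eq_bigr => i _; rewrite mulr_sumr.
  by apply: eq_bigr => y _; rewrite mulrA.
by apply: (cvg_big add_continuous) => y _; apply: cvgMr_tmp.
Qed.

(** Both sides run over the triangle i + j < N, the left one along the diagonals i + j = m. *)
Lemma sum_antidiagonal (a : nat -> nat -> R) N :
  \sum_(m < N) \sum_(i < m.+1) a i (m - i)%N
    = \sum_(i < N) \sum_(j < N - i) a i j.
Proof.
elim: N => [|N IH]; first by rewrite !big_ord0.
rewrite big_ord_recr /= IH.
transitivity (\sum_(i < N.+1) (\sum_(j < N - i) a i j + a i (N - i)%N)).
  rewrite big_split /=; congr (_ + _).
  by rewrite big_ord_recr /= subnn big_ord0 addr0.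
by apply: eq_bigr => i _; rewrite subSn ?big_ord_recr // -ltnS.
Qed.

(** Binomial theorem for [K + 1]: among m lazy steps, the number of steps of [K] is binomial with
    parameter 1/2. *)
Lemma act_lazy_half_exp K f x m :
  act (lazy_chain (1 / 2) K ^+ m) f x
    = \sum_(i < m.+1) (1 / 2) ^+ m * 'C(m, i)%:R * act (K ^+ i) f x.
Proof.
have -> : lazy_chain (1 / 2) K = (1 / 2 : R) *: (K + 1).
  rewrite /lazy_chain scalerDr addrC; congr (_ *: _ + _).
  by field.
rewrite exprZn exprD1n /act; under eq_bigr do
  rewrite mxE summxE mulr_sumr mulr_suml.
rewrite exchange_big /=; apply: eq_bigr => i _; rewrite mulr_sumr.
by apply: eq_bigr => y _; rewrite mulmxnE -mulr_natr; ring.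
Qed.

(** Keeping each of Poisson(2t) many points with probability 1/2 yields independent Poisson(t)
    numbers of kept and discarded points. *)
Lemma poisson_thinning t (i m : nat) : (i <= m)%N ->
  poisson (2 * t) m * ((1 / 2) ^+ m * 'C(m, i)%:R)
    = poisson t i * poisson t (m - i).
Proof.
move=> im; have := bin_fact im => /(congr1 (GRing.natmul (1 : R))).
rewrite !natrM => binE.
have f0 k : k`!%:R != 0 :> R by rewrite pnatr_eq0 -lt0n fact_gt0.
have C0 : 'C(m, i)%:R != 0 :> R by rewrite pnatr_eq0 -lt0n bin_gt0.
have two k : (1 / 2) ^+ k * 2 ^+ k = 1 :> R.
  by rewrite -exprMn divfK ?expr1n // pnatr_eq0.
have -> : poisson (2 * t) m * ((1 / 2) ^+ m * 'C(m, i)%:R)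
    = poisson t m * expR (- t) * 'C(m, i)%:R * ((1 / 2) ^+ m * 2 ^+ m).
  rewrite /poisson exprMn; have -> : - (2 * t) = - t + - t by ring.
  by rewrite expRD; ring.
rewrite two mulr1 /poisson -{1}(subnKC im) exprD -binE.
by field; rewrite !f0 C0.
Qed.

(* H_t = exp(- 2t (I - K_{1/2})): the semigroup is the 1/2-lazy chain run at the
   jump times of a Poisson process of rate 2. *)
Lemma act_semigroup_lazy_cvg K t f x : stochastic K -> 0 <= t ->
  (forall y, 0 <= f y <= 1) ->
  \sum_(m < N) poisson (2 * t) m * act (lazy_chain (1 / 2) K ^+ m) f x
    @[N --> \oo] --> act (semigroup K t) f x.
Proof.
move=> sK t0 f01.
(* Truncation at m < N leaves, for i kept points, a Poisson sum over j < N - i discarded ones. *)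
have thin (a : nat -> R) N :
    \sum_(m < N) poisson (2 * t) m
        * \sum_(i < m.+1) (1 / 2) ^+ m * 'C(m, i)%:R * a i
      = \sum_(i < N) poisson t i * a i * \sum_(j < N - i) poisson t j.
  under [RHS]eq_bigr do rewrite mulr_sumr.
  rewrite -(sum_antidiagonal (fun i j => poisson t i * a i * poisson t j)).
  apply: eq_bigr => m _; rewrite mulr_sumr.
  apply: eq_bigr => i _; rewrite mulrA poisson_thinning; last by rewrite -ltnS.
  by rewrite mulrAC.
pose S s N := \sum_(i < N) poisson s i.
have S2 N : S (2 * t) N = \sum_(i < N) poisson t i * S t (N - i)%N.
  transitivity (\sum_(i < N) poisson t i * 1 * S t (N - i)%N); last first.
    by apply: eq_bigr => i _; rewrite mulr1.
  rewrite -(thin (fun=> 1)); apply: eq_bigr => m _.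
  under eq_bigr do rewrite mulr1.
  rewrite -mulr_sumr -natr_sum.
  have -> : (\sum_(i < m.+1) 'C(m, i) = 2 ^ m)%N.
    rewrite -[2%N]/(1 + 1)%N expnDn; apply: eq_bigr => i _.
    by rewrite !exp1n !muln1.
  by rewrite natrX -exprMn divfK ?pnatr_eq0 // expr1n mulr1.
pose A N := \sum_(i < N) poisson t i * act (K ^+ i) f x.
have Acvg : A N @[N --> \oo] --> act (semigroup K t) f x.
  exact: act_semigroup_cvg.
(* Since the averaged values lie in [0,1], truncation loses at most [S t N - S (2 * t) N], a
   difference of two sequences tending to 1. The partial sums are squeezed between this sequence and
   [A]. *)
have diff_cvg : A N - (S t N - S (2 * t) N) @[N --> \oo]
    --> act (semigroup K t) f x.
  rewrite -[X in _ --> X]subr0; apply: cvgB => //.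
  rewrite -[X in _ --> X](subrr 1); apply: cvgB; exact: sum_poisson1_cvg.
apply: (squeeze_cvgr _ diff_cvg Acvg); apply: nearW => N /=.
under eq_bigr do rewrite act_lazy_half_exp.
rewrite (thin (fun i => act (K ^+ i) f x)) -/(S _ _).
have act01 i := act_itv01 x (stochasticX i sK) f01.
rewrite S2 /A lerBlDr -lerBlDl -!sumrB; apply/andP; split.
  apply: ler_sum => i _.
  have w0 := poisson_ge0 i t0; have := sum_poisson_le1 (N - i) t0.
  rewrite -/(S t (N - i)%N) => S1.
  have /andP[a0 a1] := act01 i.
  have : 0 <= poisson t i * ((1 - act (K ^+ i) f x) * (1 - S t (N - i)%N)).
    by rewrite mulr_ge0 // mulr_ge0 // subr_ge0.
  by rewrite -/(S t (N - i)%N); lra.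
apply: ler_sum => i _; have /andP[a0 _] := act01 i.
by rewrite ler_piMr ?sum_poisson_le1 // mulr_ge0 ?poisson_ge0.
Qed.

(** The Poisson(2t) weight of m times 2t / (m + 1) is the weight of m + 1, and the shifted weights
    sum to at most 1. *)
Lemma semigroup_sub_le K t f x c a b : stochastic K -> 0 <= t ->
  (forall y, 0 <= f y <= 1) -> 0 <= b ->
  (forall m, act (lazy_chain (1 / 2) K ^+ m) f x - c
     <= a + b * (2 * t) / m.+1%:R) ->
  act (semigroup K t) f x - c <= a + b.
Proof.
move=> sK t0 f01 b0 lazy_le; rewrite lerBlDr.
have t20 : 0 <= 2 * t by rewrite mulr_ge0.
have rhs : (a + c) * (\sum_(m < N) poisson (2 * t) m) + b @[N --> \oo]
    --> (a + c) * 1 + b.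
  by apply: cvgD; [apply: cvgMl_tmp; exact: sum_poisson1_cvg | exact: cvg_cst].
have -> : a + b + c = (a + c) * 1 + b by ring.
apply: (ler_cvg_to (act_semigroup_lazy_cvg (f := f) (x := x) sK t0 f01) rhs).
apply: nearW => N.
apply: (@le_trans _ _ ((a + c) * (\sum_(m < N) poisson (2 * t) m)
    + b * \sum_(m < N) poisson (2 * t) m.+1)).
  rewrite !mulr_sumr -big_split /=; apply: ler_sum => m _.
  have w0 := poisson_ge0 m t20.
  have -> : poisson (2 * t) m.+1 = poisson (2 * t) m * (2 * t) / m.+1%:R.
    rewrite /poisson factS natrM exprSr.
    have f0 : m`!%:R != 0 :> R by rewrite pnatr_eq0 -lt0n fact_gt0.
    move: (m.+1%:R) (ltr0Sn R m) (m`!%:R) f0 => M M0 F F0.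
    by field; rewrite F0 lt0r_neq0.
  have := lazy_le m; rewrite lerBlDr => /(ler_wpM2l w0) /le_trans; apply.
  by rewrite le_eqVlt; apply/orP; left; apply/eqP; ring.
rewrite lerD2l ler_piMr //; apply: le_trans (sum_poisson_le1 N.+1 t20).
by rewrite big_ord_recl lerDr poisson_ge0.
Qed.

(** Averaging the growth factor (1 + theta)^i over Poisson(t) gives exp(theta t), by the generating
    function of the Poisson law. *)
Lemma semigroup_exp_moment_le K t theta (G : 'I_n.+1 -> R) x : stochastic K ->
  0 <= t -> (forall y, 0 <= G y) -> (forall y, act K G y <= G y + 1) ->
  0 <= theta ->
  act (semigroup K t) (fun y => 1 + theta * G y) x
    <= expR (theta * t) * (1 + theta * G x).
Proof.
move=> sK t0 G0 KG th0.
have lhs := act_semigroup_cvg (f := fun y => 1 + theta * G y) (x := x) sK t0.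
have rhs : (\sum_(i < N) poisson t i * (1 + theta) ^+ i) * (1 + theta * G x)
    @[N --> \oo] --> expR (theta * t) * (1 + theta * G x).
  apply: cvgMr_tmp.
  have := @sum_poisson_cvg (1 + theta) t.
  by have -> : t * (1 + theta - 1) = theta * t by ring.
apply: (ler_cvg_to lhs rhs); apply: nearW => N.
rewrite mulr_suml; apply: ler_sum => i _; rewrite -mulrA.
rewrite ler_wpM2l ?poisson_ge0 //.
by have := actX_exp_moment_le i x sK G0 KG th0 ler01; rewrite mulr1.
Qed.

End Poissonization.

(** * Distance from equilibrium by Markov's inequality *)

Section MixingTimes.
Variables (R : realType) (n : nat).
Implicit Types (K P : 'M[R]_n.+1) (mu : 'rV[R]_n.+1).

Lemma stochastic_semigroup K t : stochastic K -> 0 <= t ->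
  stochastic (semigroup K t).
Proof.
move=> sK t0; split=> [x y|x].
  have entryE (A : 'M[R]_n.+1) : A x y = act A (fun z => (z == y)%:R) x.
    rewrite /act (bigD1 y) //= eqxx mulr1 big1 ?addr0 // => z /negbTE ->.
    by rewrite mulr0.
  rewrite entryE; apply: (cvgr_to_ge (act_semigroup_cvg sK t0)).
  apply: nearW => N; apply: sumr_ge0 => i _.
  by rewrite mulr_ge0 ?poisson_ge0 // -entryE (stochasticX i sK).1.
rewrite -act_one; have := act_semigroup_cvg (f := fun=> 1) (x := x) sK t0.
have -> : (fun N => \sum_(i < N) poisson t i * act (K ^+ i) (fun=> 1) x)
    = (fun N => \sum_(i < N) poisson t i).
  apply/funext => N; apply: eq_bigr => i _.
  by rewrite act_cst ?mulr1 //; exact: stochasticX.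
by move=> /cvg_lim <- //; apply: cvg_lim => //; exact: sum_poisson1_cvg.
Qed.

(** From exp(-1/12) >= 11/12 follows exp(1/12) <= 12/11, whose tenth power is below 12/5. The target
    12/5 is 6 times 2/5. *)
Lemma expR_5div6_lt : expR (5 / 6) < 12 / 5 :> R.
Proof.
have e12 : expR (1 / 12) <= 12 / 11 :> R.
  have -> : 1 / 12 = - (- (1 / 12)) :> R by ring.
  have := @expR_ge1Dx R (- (1 / 12)); rewrite [expR (- - _)]expRN => h.
  have -> : 12 / 11 = (11 / 12)^-1 :> R by field.
  by rewrite lef_pV2 ?posrE ?expR_gt0 //; lra.
have -> : 5 / 6 = 10%:R * (1 / 12) :> R by field.
rewrite expRM_natl.
apply: le_lt_trans (_ : (12 / 11) ^+ 10 < _).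
  by rewrite lerXn2r ?nnegrE ?expR_ge0.
by rewrite !exprS expr0; lra.
Qed.

(** Markov's inequality: the function 1 + (5 / T) G is at least 6 on [S], while its mean from x is
    at most exp(5/6) < 12/5. So [S] has mass below 2/5 under row x of [P], against at least 1/2
    under mu. *)
Lemma max_tv_dist_gt P mu (G : 'I_n.+1 -> R) x (S : {set 'I_n.+1}) T s :
  stochastic P -> is_distribution mu ->
  (forall y, 0 <= G y) -> G x = 0 -> (forall y, y \in S -> T <= G y) ->
  1 / 2 <= mass mu S -> 0 < T -> s <= T / 6 ->
  act P (fun y => 1 + 5 / T * G y) x <= expR (5 / T * s) * (1 + 5 / T * G x) ->
  1 / 10 < max_tv_dist P mu.
Proof.
move=> sP [mu0 mu1] G0 Gx GS muS T0 sT moment.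
have small : 6 * act P (fun y => (y \in S)%:R) x < 12 / 5.
  apply: le_lt_trans expR_5div6_lt.
  have -> : 5 / 6 = 5 / T * (T / 6) by field; rewrite lt0r_neq0.
  rewrite -actZ; apply: (@le_trans _ _ (expR (5 / T * s))); last first.
    by rewrite ler_expR ler_wpM2l // divr_ge0 // ltW.
  move: moment; rewrite Gx mulr0 addr0 mulr1; apply: le_trans.
  apply: act_le => [y|y]; first exact: sP.1.
  have G5 : 0 <= 5 / T * G y by rewrite mulr_ge0 ?divr_ge0 // ltW.
  have [/GS TG|_] := boolP (y \in S); last by rewrite mulr0 addr_ge0.
  have : 5 / T * T <= 5 / T * G y by rewrite ler_wpM2l // divr_ge0 // ltW.
  by rewrite divfK ?lt0r_neq0 // mulr1; lra.
(* The distance subtracts mu from the evolved law, so the event to test is the complement of [S],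
   which the evolved law favours. *)
apply: lt_le_trans (le_max_tv_dist P mu x (~: S)%SET).
have compl (a : 'I_n.+1 -> R) :
    \sum_y a y * (y \in ~: S)%SET%:R = \sum_y a y - \sum_y a y * (y \in S)%:R.
  rewrite -sumrB; apply: eq_bigr => y _; rewrite inE.
  by case: (y \in S); rewrite ?mulr1 ?mulr0 ?subrr ?subr0.
move: muS small; rewrite mass_row !massE /act !compl mu1 sP.2; lra.
Qed.

End MixingTimes.

(** * Quantitative mixing of birth and death chains *)

Section BirthDeathMixing.
Variables (R : realType) (n : nat) (p q r : 'I_n.+1 -> R).
Hypothesis rates : birth_death_rates p q r.
Let K := birth_death_mx p q r.
Hypothesis irr : irreducible_chain K.
Variable mu : 'rV[R]_n.+1.
Hypothesis mu_st : stationary_distribution K mu.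
Variable i0 : 'I_n.+1.

Lemma hitting_sum_ge0 : 0 <= hitting_sum p q mu i0.
Proof.
rewrite le_max; apply/orP; left; apply: sumr_ge0 => k _.
exact: (ascent_term_ge0 rates mu_st).
Qed.

Hypothesis lower_half : 1 / 2 <= mass mu (states n 0 i0).
Hypothesis upper_half : 1 / 2 <= mass mu (states n i0 n).

(** The larger of the two sums decides the direction: from n down to [0,i0], or from 0 up to [i0,n].
    [G] stops growing at i0, hence equals the larger sum on all of [S]. *)
Lemma hitting_potential : 0 < hitting_sum p q mu i0 ->
  exists (G : 'I_n.+1 -> R) (x : 'I_n.+1) (S : {set 'I_n.+1}),
    [/\ forall y, 0 <= G y, G x = 0,
        forall y, y \in S -> hitting_sum p q mu i0 <= G y,
        1 / 2 <= mass mu S & forall y, act K G y <= G y + 1].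
Proof.
move=> t0; rewrite /hitting_sum; case: leP => _.
- pose V (k : 'I_n.+1) := (i0 < k)%N.
  exists (fun y => descent q mu V y), ord_max, (states n 0 i0); split=> //.
  + by move=> y; exact: (descent_ge0 rates mu_st).
  + by rewrite /descent big1 // => k /andP[]; rewrite /= ltnNge -ltnS ltn_ord.
  + move=> y; rewrite inE /= => yi0; rewrite /descent le_eqVlt.
    apply/orP; left; apply/eqP/eq_bigl => k; rewrite /V.
    by case: (ltnP i0 k) => [ik|]; rewrite ?andbF // (leq_ltn_trans yi0 ik).
  + move=> y; apply: (act_descent rates irr mu_st y _ _).2 => [i j ij|i].
      by rewrite /V => ii; exact: leq_trans ij.
    by rewrite /V; exact: leq_ltn_trans.
- pose U (k : 'I_n.+1) := (k < i0)%N.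
  exists (fun y => ascent p mu U y), ord0, (states n i0 n); split=> //.
  + by move=> y; exact: (ascent_ge0 rates mu_st).
  + by rewrite /ascent big1.
  + move=> y; rewrite inE => /andP[iy _]; rewrite /ascent le_eqVlt.
    apply/orP; left; apply/eqP/eq_bigl => k; rewrite /U.
    by case: (ltnP k i0) => [ki|]; rewrite ?andbF // (leq_trans ki iy).
  + move=> y; apply: (act_ascent rates irr mu_st y _ _).2 => [i j ij|i].
      by rewrite /U; exact: leq_ltn_trans.
    by rewrite /U => ii; rewrite (leq_trans ii) // -ltnS.
Qed.

Lemma semigroup_tv_gt s : 0 <= s -> s < hitting_sum p q mu i0 / 6 ->
  1 / 10 < max_tv_dist (semigroup K s) mu.
Proof.
move=> s0 st; have t0 : 0 < hitting_sum p q mu i0 by lra.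
have sK := stochastic_birth_death rates.
have [G [x [S [G0 Gx GS muS KG]]]] := hitting_potential t0.
apply: (max_tv_dist_gt (stochastic_semigroup sK s0) mu_st.1 G0 Gx GS muS t0
  (ltW st)).
by apply: semigroup_exp_moment_le; rewrite // divr_ge0 // ltW.
Qed.

(** Laziness lowers the drift bound to 1 - delta, so m steps count as time (1 - delta) m <= m, and 1
    + u <= exp(u) bounds the growth factor by the exponential one. *)
Lemma lazy_tv_gt delta m : 0 <= delta <= 1 ->
  m%:R < hitting_sum p q mu i0 / 6 ->
  1 / 10 < max_tv_dist (lazy_chain delta K ^+ m) mu.
Proof.
move=> /[dup] d01 /andP[d0 d1] mt.
have m0 : 0 <= m%:R :> R by [].
have t0 : 0 < hitting_sum p q mu i0 by lra.
have sK := stochastic_lazy d01 (stochastic_birth_death rates).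
have [G [x [S [G0 Gx GS muS KG]]]] := hitting_potential t0.
have th0 : 0 <= 5 / hitting_sum p q mu i0 by rewrite divr_ge0 // ltW.
have d1' : 0 <= 1 - delta by lra.
have mdt : (1 - delta) * m%:R <= hitting_sum p q mu i0 / 6.
  by apply: le_trans (ltW mt); rewrite ler_piMl //; lra.
apply: (max_tv_dist_gt (stochasticX m sK) mu_st.1 G0 Gx GS muS t0 mdt).
have drift y : act (lazy_chain delta K) G y <= G y + (1 - delta).
  by rewrite act_lazy; have := ler_wpM2l d1' (KG y); lra.
apply: le_trans (actX_exp_moment_le m x sK G0 drift th0 d1') _.
rewrite Gx mulr0 addr0 !mulr1 mulrA expRM_natr lerXn2r ?nnegrE ?expR_ge0 //.
  by rewrite addr_ge0 // mulr_ge0.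
exact: expR_ge1Dx.
Qed.

(** This fixes the constant 18: with eps / 4 for the tail level, 1 + 8 / eps <= 9 / eps, and 9 / eps
    is eps / 2 times 18 / eps^2. *)
Lemma lazy_mixing_le delta eps f x m : 1 / 2 <= delta < 1 -> 0 < eps < 1 ->
  (forall y, 0 <= f y <= 1) ->
  act (lazy_chain delta K ^+ m) f x - \sum_y mu 0 y * f y
    <= eps / 2 + eps / 2 * (18 * hitting_sum p q mu i0 / eps ^+ 2)
        / ((1 - delta) * m.+1%:R).
Proof.
move=> d01 /andP[e0 e1] f01.
have e40 : 0 < eps / 4 by rewrite divr_gt0.
apply: le_trans (lazy_expectation_le rates irr mu_st e40 i0 x m d01 f01) _.
have -> : 2 * (eps / 4) = eps / 2 by field.
have d1 : 0 < 1 - delta by lra.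
rewrite lerD2l ler_pM2r ?invr_gt0 ?mulr_gt0 //.
have -> : eps / 2 * (18 * hitting_sum p q mu i0 / eps ^+ 2)
    = (1 / eps + 8 / eps) * hitting_sum p q mu i0.
  by field; rewrite lt0r_neq0.
rewrite ler_wpM2r ?hitting_sum_ge0 // lerD //.
  by rewrite ler_pdivlMr // mul1r ltW.
by rewrite le_eqVlt; apply/orP; left; apply/eqP; field; rewrite lt0r_neq0.
Qed.

Lemma semigroup_tv_le eps : 0 < eps < 1 ->
  max_tv_dist (semigroup K (18 * hitting_sum p q mu i0 / eps ^+ 2)) mu <= eps.
Proof.
move=> e01; have /andP[e0 e1] := e01.
set s := 18 * _ / _.
have s0 : 0 <= s by rewrite divr_ge0 ?exprn_ge0 ?mulr_ge0 ?hitting_sum_ge0 // ltW.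
apply: max_tv_dist_le => x S; rewrite mass_row massE.
have -> : eps = eps / 2 + eps / 2 by field.
have f01 y : 0 <= ((y \in S)%:R : R) <= 1 by case: (y \in S); rewrite /= lexx ler01.
apply: (semigroup_sub_le (stochastic_birth_death rates) s0 f01) => [|m].
  by rewrite divr_ge0 // ltW.
(* At delta = 1/2 the error term is eps / 2 times 2s / (m + 1), the form averaged by
   [semigroup_sub_le]. *)
have half : 1 / 2 <= (1 / 2 : R) < 1 by lra.
apply: le_trans (lazy_mixing_le x m half e01 f01) _; rewrite lerD2l -/s.
rewrite le_eqVlt; apply/orP; left; apply/eqP.
by move: (m.+1%:R) (ltr0Sn R m) => M M0; field; rewrite lt0r_neq0.
Qed.

Lemma lazy_tv_le delta eps m : 1 / 2 <= delta < 1 -> 0 < eps < 1 ->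
  18 * hitting_sum p q mu i0 / eps ^+ 2 <= (1 - delta) * m.+1%:R ->
  max_tv_dist (lazy_chain delta K ^+ m) mu <= eps.
Proof.
move=> d01 e01 sm; have /andP[e0 e1] := e01; have /andP[d0 d1] := d01.
apply: max_tv_dist_le => x S; rewrite mass_row massE.
have f01 y : 0 <= ((y \in S)%:R : R) <= 1 by case: (y \in S); rewrite /= lexx ler01.
apply: le_trans (lazy_mixing_le x m d01 e01 f01) _.
have dm0 : 0 < (1 - delta) * m.+1%:R by rewrite mulr_gt0 // subr_gt0.
rewrite [leRHS]splitr lerD2l -mulrA; apply: ler_piMr.
  by rewrite divr_ge0 // ltW.
by rewrite ler_pdivrMr // mul1r.
Qed.

End BirthDeathMixing.

(** * From distance bounds to mixing times *)

Theorem theorem1p1 (R : realType) (n : nat) (hn : (1 <= n)%N)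
    (p q r : 'I_n.+1 -> R) (hrates : birth_death_rates p q r)
    (hirr : irreducible_chain (birth_death_mx p q r))
    (pi : 'rV[R]_n.+1)
    (hpi : stationary_distribution (birth_death_mx p q r) pi)
    (i0 : 'I_n.+1)
    (hleft : 1 / 2 <= mass pi (states n 0 i0))
    (hright : 1 / 2 <= mass pi (states n i0 n))
    (delta : R) (hdelta : 1 / 2 <= delta < 1) :
  let K := birth_death_mx p q r in
  let t := hitting_sum p q pi i0 in
  ((t / 6)%:E <= Order.min (ct_mixing_time K pi (1 / 10))
                           (lazy_mixing_time delta K pi (1 / 20)))%E /\
  (forall eps : R, 0 < eps < 1 ->
     (Order.max (ct_mixing_time K pi eps)
                ((1 - delta)%:E * lazy_mixing_time delta K pi eps)
      <= (18 * t / eps ^+ 2)%:E)%E).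
Proof.
move=> K t; have /andP[d0 d1] := hdelta; split=> [|eps e01].
- rewrite le_min; apply/andP; split; apply: le_ereal_inf_tmp.
  + move=> _ [s [s0 tv_s] <-]; rewrite lee_fin leNgt; apply/negP => st.
    by have := semigroup_tv_gt hrates hirr hpi hleft hright s0 st; rewrite ltNge tv_s.
  + move=> _ [m tv_m <-]; rewrite lee_fin leNgt; apply/negP => mt.
    have d01 : 0 <= delta <= 1 by lra.
    have := lazy_tv_gt hrates hirr hpi hleft hright d01 mt.
    by rewrite ltNge (le_trans tv_m) //; lra.
- have /andP[e0 e1] := e01.
  have s0 : 0 <= 18 * t / eps ^+ 2.
    by rewrite divr_ge0 ?exprn_ge0 ?mulr_ge0 ?(hitting_sum_ge0 hrates hpi) // ltW.
  rewrite ge_max; apply/andP; split.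
    apply: ereal_inf_lbound; exists (18 * t / eps ^+ 2) => //; split=> //.
    exact: (semigroup_tv_le hrates hirr hpi).
  have d1' : 0 < 1 - delta by rewrite subr_gt0.
  set s := 18 * t / eps ^+ 2 in s0 *.
  (* The time is the floor m of s / (1 - delta), so (1 - delta) m <= s; the m + 1 in the mixing
     bound makes rounding down admissible. *)
  have /andP[m_le m_gt] := truncn_itv (divr_ge0 s0 (ltW d1')).
  set m := Num.truncn _ in m_le m_gt.
  have : (lazy_mixing_time delta K pi eps <= m%:R%:E)%E.
    apply: ereal_inf_lbound; exists m => //.
    apply: (lazy_tv_le (i0 := i0) hrates hirr hpi hdelta e01).
    by move: m_gt; rewrite ltr_pdivrMr // mulrC => /ltW.
  move=> /(lee_wpmul2l (_ : (0 <= (1 - delta)%:E)%E)) /le_trans; apply.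
    by rewrite lee_fin ltW.
  by rewrite -EFinM lee_fin mulrC -ler_pdivlMr.
Qed.
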